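(* The following holds for every integer $n\geq 1$. (i) For every set $\mathcal{X}\in\mathcal{A}(n)$ (i.e. every set $\mathcal{X}$ of $n$ distinct points in $\mathbb{R}^2$) there exists an admissible billiard trajectory $\Gamma\in\mathcal{G}(\mathcal{X})$ with $|\Gamma|\geq \lfloor \sqrt{n-1}+1\rfloor$. (ii) There exists a set $\mathcal{X}\in\mathcal{A}(n)$ such that $|\Gamma|\leq 3\lceil \sqrt{n}\,\rceil$ for every admissible billiard trajectory $\Gamma\in\mathcal{G}(\mathcal{X})$.
   Context: The angle between two line segments sharing an endpoint always means the smaller of the two angles, i.e. the one in the range $[0,\pi]$. For an integer $n\ge 1$, $\mathcal{A}(n)$ denotes the family of all sets of $n$ distinct points in $\mathbb{R}^2$. Given $\mathcal{X}=\{x_1,\dots,x_n\}\in\mathcal{A}(n)$, an admissible billiard trajectory $\Gamma$ (relative to $\mathcal{X}$) is a polygonal line with vertices $y_1,y_2,\dots,y_k$ (in this order) such that $k\leq n$, all $y_1,\dots,y_k$ are distinct, each $y_j$ is equal to some $x_m$, and for all $2\leq j\leq k-1$ the angle between the line segments $\overline{y_{j-1},y_j}$ and $\overline{y_j,y_{j+1}}$ (at their common endpoint $y_j$) is in the range $(\pi/2,\pi]$. The number $k$ of vertices is called the length of $\Gamma$ and is denoted $|\Gamma|=k$. The set of all admissible billiard trajectories relative to $\mathcal{X}$ is denoted $\mathcal{G}(\mathcal{X})$. $\lfloor\cdot\rfloor$ and $\lceil\cdot\rceil$ denote the floor and ceiling functions. *)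

(* Defs.v *)
From mathcomp Require Import all_boot all_order all_algebra.
From mathcomp Require Import finmap.
From mathcomp Require Import all_classical all_reals all_analysis.

Set Implicit Arguments.
Unset Strict Implicit.
Unset Printing Implicit Defensive.

Import Order.TTheory GRing.Theory Num.Theory.

Local Open Scope ring_scope.

(* The library's norm on row vectors is the sup norm, hence the explicit
   Euclidean structure. *)
Definition dotv (R : realType) (d : nat) (u v : 'rV[R]_d) : R :=
  \sum_(i < d) u 0 i * v 0 i.

Definition enorm (R : realType) (d : nat) (u : 'rV[R]_d) : R :=
  Num.sqrt (dotv u u).

(* Angle at b between the segments [b, a] and [b, c], in [0, pi]; meaningful
   when a != b and c != b. *)
Definition angle (R : realType) (d : nat) (a b c : 'rV[R]_d) : R :=
  acos (dotv (a - b) (c - b) / (enorm (a - b) * enorm (c - b))).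

(* A trajectory is the sequence of its vertices y_1, ..., y_k (G`_0, ...,
   G`_k.-1), its length being size G. *)
Definition admissible (R : realType) (X : {fset 'rV[R]_2})
    (G : seq 'rV[R]_2) : Prop :=
  [/\ (0 < size G <= #|` X|)%N,
      uniq G,
      {subset G <= X}
    & forall j : nat, (j.+2 < size G)%N ->
        pi / 2 < angle G`_j G`_j.+1 G`_j.+2 <= pi].

(* Main.v *)
Require Import Defs.
From mathcomp Require Import all_boot all_order all_algebra.
From mathcomp Require Import finmap.
From mathcomp Require Import all_classical all_reals all_analysis.
From mathcomp Require Import zify ring lra.

(** An angle exceeds [pi / 2] exactly when the two consecutive steps have a
    positive dot product.

    Lower bound: every nonzero vector or its opposite lies in exactly one of the
    half-open quadrants [dx >= 0, dy > 0] and [dx > 0, dy <= 0], and two vectors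
    of the same quadrant have positive dot product.  Erdős–Szekeres applied to
    the corresponding orders yields a long trajectory among any n points.

    Upper bound: put m tiny collinear clusters of m points along a flat parabola,
    each directed along the inner normal [v_i] of the parabola at its base point.
    By convexity every step leaving a cluster has a positive [v_i] component, so a
    trajectory which enters a cluster and moves inside it goes outwards and is
    trapped there.  Hence at most the first and the last cluster are visited in
    more than one point, and in between the flatness forces the cluster index to
    be monotone. *)

Import Order.TTheory GRing.Theory Num.Theory.

Set Implicit Arguments.
Unset Strict Implicit.
Unset Printing Implicit Defensive.

Local Open Scope ring_scope.

(** * Obtuse angles and the sign of a dot product *)

Section ObtuseAngle.
Variable R : realType.
Implicit Types a b c u v w : 'rV[R]_2.

Lemma dotvE u v : dotv u v = u 0 0 * v 0 0 + u 0 1 * v 0 1.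
Proof.
rewrite /dotv big_ord_recl big_ord_recl big_ord0 addr0.
by congr (_ + u 0 _ * v 0 _); apply/val_inj.
Qed.

Lemma dotv_ge0 u : 0 <= dotv u u.
Proof. by rewrite dotvE; nra. Qed.

(** Cauchy-Schwarz, via the Lagrange identity: the defect of the squares is the square of a
    determinant. *)
Lemma norm_dotv_le u v : `|dotv u v| <= enorm u * enorm v.
Proof.
rewrite -sqrtrM ?dotv_ge0 // -sqrtr_sqr ler_wsqrtr //.
rewrite !dotvE -subr_ge0 [leRHS](_ : _ =
  (u 0 0 * v 0 1 - u 0 1 * v 0 0) ^+ 2) ?sqr_ge0 //; ring.
Qed.

Lemma row2_eq u v : u 0 0 = v 0 0 -> u 0 1 = v 0 1 -> u = v.
Proof.
move=> h0 h1; apply/rowP => i.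
case: (unliftP 0 i) => [j ->|-> //].
by rewrite ord1 (_ : lift 0 0 = 1) //; apply/val_inj.
Qed.

Lemma angle_obtuseE a b c :
  (pi / 2 < angle a b c <= pi) = (0 < dotv (b - a) (c - b)).
Proof.
have -> : dotv (b - a) (c - b) = - dotv (a - b) (c - b).
  by rewrite !dotvE !mxE; ring.
rewrite /angle oppr_gt0; set d := dotv _ _; set e := enorm _ * _.
have de : `|d| <= e by exact: norm_dotv_le.
have e0 : 0 <= e by apply: le_trans de.
have qle : -1 <= d / e <= 1.
  have [e00|ep] := eqVneq e 0; first by rewrite e00 invr0 mulr0; lra.
  have {}ep : 0 < e by rewrite lt_def ep.
  by rewrite ler_pdivlMr // ler_pdivrMr // mulN1r mul1r -ler_norml.
rewrite acos_lepi // andbT.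
have pi0 := pi_gt0 R.
have [/andP[a0 api] ca] := acos_def qle.
rewrite -(@ltr_cos R) ?cos_pihalf ?ca; last 2 first.
- by rewrite in_itv /=; lra.
- by rewrite in_itv /=; apply/andP.
(* If two consecutive points coincide, the quotient is 0 by convention and the angle is [pi / 2], so
   both sides are false. *)
have [e00|ep] := eqVneq e 0.
  have d0 : d = 0 by apply/normr0_eq0/le_anti; rewrite normr_ge0 andbT -e00.
  by rewrite d0 mul0r.
by rewrite pmulr_llt0 // invr_gt0 lt_def ep.
Qed.

End ObtuseAngle.

(** * Chains and antichains of a relation *)

Section ChainAntichain.
Variables (T : eqType) (r : rel T).

(* Peel off the minimal elements, an antichain, and extend downwards a chain of
   what remains. *)
Lemma chain_or_antichain (m k : nat) (s : seq T) :
  uniq s -> (m * k < size s)%N ->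
  (exists c, [/\ size c = m.+1, {subset c <= s} & sorted r c]) \/
  (exists A, [/\ (k < size A)%N, uniq A, {subset A <= s} &
                 {in A &, forall x y, ~~ r x y}]).
Proof.
elim: m s => [|m IH] s us sz.
  left; case: s sz {us} => // x s _; exists [:: x]; split=> // y.
  by rewrite inE => /eqP ->; rewrite mem_head.
pose low x := has (r^~ x) s.
have [big|small] := ltnP k (size [seq x <- s | ~~ low x]).
  right; exists [seq x <- s | ~~ low x]; split=> //; first exact: filter_uniq.
    by move=> x; rewrite mem_filter => /andP[].
  move=> x y; rewrite !mem_filter => /andP[_ xs] /andP[/hasPn ny _].
  exact: ny.
have := count_predC low s; rewrite -!size_filter => szE.
have ss : {subset [seq x <- s | low x] <= s}.
  by move=> x; rewrite mem_filter => /andP[].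
case: (IH [seq x <- s | low x]).
- exact: filter_uniq.
- have -> : size [seq x <- s | low x] = (size s - size [seq x <- s | ~~ low x])%N.
    by rewrite -szE addnK.
  by rewrite mulSn in sz; lia.
- case=> -[|x c] [// szc cs sc]; left.
  have := cs x (mem_head _ _); rewrite mem_filter => /andP[/hasP[y ys ryx] _].
  exists [:: y, x & c]; split; rewrite /= ?ryx //; first by rewrite -szc.
  move=> z; rewrite inE => /predU1P[-> //|zc]; exact/ss/cs.
- case=> A [szA uA As nA]; right; exists A; split=> // x xA.
  exact/ss/As.
Qed.

End ChainAntichain.

(** * Long trajectories among arbitrary points *)

Section LowerBound.
Variable R : realType.
Implicit Types u v w : 'rV[R]_2.

Definition quadrant1 u v : bool := (u 0 0 <= v 0 0) && (u 0 1 < v 0 1).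
Definition quadrant2 u v : bool := (u 0 0 < v 0 0) && (v 0 1 <= u 0 1).

Lemma quadrant1_obtuse u v w :
  quadrant1 u v -> quadrant1 v w -> 0 < dotv (v - u) (w - v).
Proof. by move=> /andP[? ?] /andP[? ?]; rewrite dotvE !mxE; nra. Qed.

Lemma quadrant2_obtuse u v w :
  quadrant2 u v -> quadrant2 v w -> 0 < dotv (v - u) (w - v).
Proof. by move=> /andP[? ?] /andP[? ?]; rewrite dotvE !mxE; nra. Qed.

Lemma quadrant_total u v :
  [|| u == v, quadrant1 u v, quadrant1 v u, quadrant2 u v | quadrant2 v u].
Proof.
rewrite /quadrant1 /quadrant2.
have [x|x|x] := ltgtP (u 0 0) (v 0 0); have [y|y|y] := ltgtP (u 0 1) (v 0 1);
  rewrite ?orbT //=.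
by rewrite (row2_eq x y) eqxx.
Qed.

(** An antichain for [quadrant1] is totally ordered by [quadrant2], so sorting it turns it into a
    [quadrant2] chain. *)
Lemma monotone_subsequence (m : nat) (s : seq 'rV[R]_2) :
  uniq s -> (m * m < size s)%N ->
  exists G, [/\ (m < size G)%N, uniq G, {subset G <= s} &
    sorted quadrant1 G \/ sorted quadrant2 G].
Proof.
move=> us sz; case: (chain_or_antichain quadrant1 us sz).
  case=> c [szc cs sc]; exists c; split=> //; [by rewrite szc| |by left].
  apply: sorted_uniq sc; first by move=> u v w /andP[? ?] /andP[? ?]; apply/andP; lra.
  by move=> u; rewrite /quadrant1 ltxx andbF.
case=> A [szA uA As nA].
pose le2 u v := (u == v) || quadrant2 u v.
have tot : {in A &, total le2}.
  move=> u v uA' vA; have := quadrant_total u v.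
  rewrite (negPf (nA _ _ uA' vA)) (negPf (nA _ _ vA uA')) /= /le2.
  by case/or3P => ->; rewrite ?orbT.
exists (sort le2 A); split; rewrite ?size_sort ?sort_uniq //.
  by move=> u; rewrite mem_sort; exact: As.
right; apply/(sortedP 0) => i ilt.
have /(sortedP 0)/(_ i ilt)/orP[|//] := sort_sorted_in tot (introT allP (fun _ h => h)).
(* Distinctness rules out the equality allowed by [le2]. *)
by rewrite nth_uniq ?sort_uniq // ?(ltnW ilt) // eqn_leq ltnn andbF.
Qed.

Lemma long_trajectory (X : {fset 'rV[R]_2}) (m : nat) :
  (m * m < #|` X|)%N -> exists2 G, admissible X G & (m < size G)%N.
Proof.
move=> /(monotone_subsequence (fset_uniq X))[G [szG uG GX mono]].
exists G => //; split=> //.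
  by rewrite (leq_ltn_trans _ szG) //= uniq_leq_size.
move=> j jlt; rewrite angle_obtuseE.
by case: mono => /(sortedP 0) mono; [apply: quadrant1_obtuse | apply: quadrant2_obtuse];
  apply: mono => //; apply: ltnW.
Qed.

End LowerBound.

(** * Combinatorics of walks between clusters *)

Section ClusterWalks.
Variable m : nat.
Implicit Types p q r : nat * nat.

(* Points are pairs (cluster, height); increasing height points inwards. *)
Definition cluster_turn p q r : bool :=
  if p.1 == q.1 then
    if q.1 == r.1 then (p.2 < q.2 < r.2)%N || (r.2 < q.2 < p.2)%N
    else (p.2 < q.2)%N
  else
    if q.1 == r.1 then (r.2 < q.2)%N
    else (p.1 < q.1 < r.1)%N || (r.1 < q.1 < p.1)%N.

(* The four cases are an inward step, an outward step, a step to a later and a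
   step to an earlier cluster. *)
Definition steps_left p q : nat :=
  if p.1 == q.1 then (if (p.2 < q.2)%N then 3 * m - 3 - q.2 else q.2)%N
  else (if (p.1 < q.1)%N then 2 * m - 2 - q.1 else q.1 + m - 1)%N.

(** A walk moves inwards, then through clusters monotonically, then outwards, and never returns to
    an earlier phase. Each phase has at most [m - 1] steps, and [steps_left] adds up what remains of
    the current and later phases. *)
Lemma steps_left_decreases p q r :
  (p.1 < m)%N -> (p.2 < m)%N -> (q.1 < m)%N -> (q.2 < m)%N ->
  (r.1 < m)%N -> (r.2 < m)%N ->
  cluster_turn p q r -> (steps_left q r < steps_left p q)%N.
Proof.
move: p q r => [i j] [i' j'] [i'' j'']; rewrite /cluster_turn /steps_left /=.
move=> ? ? ? ? ? ?; case: eqP => ?; case: eqP => ?;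
  case: (ltnP j j') => ?; case: (ltnP j' j'') => ?;
  case: (ltnP i i') => ?; case: (ltnP i' i'') => ?; lia.
Qed.

Lemma cluster_walk_size (g : seq (nat * nat)) :
  all (fun p => (p.1 < m) && (p.2 < m))%N g ->
  (forall k, (k.+2 < size g)%N ->
     cluster_turn (nth (0, 0) g k) (nth (0, 0) g k.+1) (nth (0, 0) g k.+2))%N ->
  (size g <= 3 * m)%N.
Proof.
case: g => [|p [|q s]] //=; first by lia.
move=> /and3P[/andP[p1 p2] /andP[q1 q2] sm] turn.
(* The potential of the first step bounds the number of points after [p] and [q]. *)
have left_ge : (size s <= steps_left p q)%N.
  elim: s p q p1 p2 q1 q2 sm turn => //= r s IH p q p1 p2 q1 q2.
  move=> /andP[/andP[r1 r2] sm] turn.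
  apply: (@leq_ltn_trans (steps_left q r)).
    by apply: IH => // k klt; exact: (turn k.+1).
  by apply: steps_left_decreases => //; exact: (turn 0%N).
move: left_ge p1 p2 q1 q2; rewrite /steps_left.
by case: eqP => ?; case: ltnP => ?; lia.
Qed.

End ClusterWalks.

(** * Clusters along a flat parabola *)

Section UpperBound.
Variables (R : realType) (m : nat) (delta eps : R).
Hypotheses (delta0 : 0 < delta) (eps0 : 0 < eps).
Hypotheses (delta_small : delta * m%:R <= 4^-1) (eps_small : eps * m%:R <= delta / 4).
Implicit Types p q r : nat * nat.

(* Cluster i starts at (i, delta i^2) and its point j is offset by
   eps j v_i, where v_i = (- 2 delta i, 1). *)
Definition px p : R := p.1%:R - 2 * delta * p.1%:R * (eps * p.2%:R).
Definition py p : R := delta * p.1%:R ^+ 2 + eps * p.2%:R.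
Definition pt p : 'rV[R]_2 := \row_i (if i == 0 then px p else py p).

Definition in_range p : bool := ((p.1 < m) && (p.2 < m))%N.

Lemma dotv_pt p q r :
  dotv (pt q - pt p) (pt r - pt q) =
  (px q - px p) * (px r - px q) + (py q - py p) * (py r - py q).
Proof. by rewrite dotvE !mxE. Qed.

Lemma in_range_bounds p : in_range p ->
  [/\ 0 <= delta * p.1%:R, delta * p.1%:R <= 4^-1, 0 <= eps * p.2%:R,
      eps * p.2%:R <= delta / 4 & delta <= 4^-1].
Proof.
case: p => i j /andP[/= im jm].
have m1 : 1 <= m%:R :> R by rewrite ler1n; apply: leq_trans im.
have iR : i%:R <= m%:R :> R by rewrite ler_nat ltnW.
have jR : j%:R <= m%:R :> R by rewrite ler_nat ltnW.
split.
- by rewrite mulr_ge0 // ltW.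
- by apply: le_trans delta_small; rewrite ler_pM2l.
- by rewrite mulr_ge0 // ltW.
- by apply: le_trans eps_small; rewrite ler_pM2l.
- by apply: le_trans delta_small; rewrite ler_peMr // ltW.
Qed.

(** The chord between base points has slope at most 1/2, and the offsets inside the clusters are too
    small to spoil this over a horizontal distance of at least 1. *)
Lemma long_step_flat p q : in_range p -> in_range q -> (p.1 < q.1)%N ->
  `|py q - py p| < px q - px p.
Proof.
move=> /in_range_bounds[a0 a4 e0 e4 d4] /in_range_bounds[b0 b4 f0 f4 _] lt.
have : p.1%:R + 1 <= q.1%:R :> R by rewrite natr1 ler_nat.
rewrite /px /py; move: a0 a4 e0 e4 b0 b4 f0 f4.
set I := p.1%:R; set J := q.1%:R; set e := eps * _; set f := eps * _.
move=> a0 a4 e0 e4 b0 b4 f0 f4 IJ.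
have -> : delta * J ^+ 2 + f - (delta * I ^+ 2 + e) =
  (J - I) * (delta * I + delta * J) + (f - e) by ring.
have -> : J - 2 * delta * J * f - (I - 2 * delta * I * e) =
  (J - I) - 2 * (delta * J) * f + 2 * (delta * I) * e by ring.
move: (delta * I) (delta * J) a0 a4 b0 b4 => a b a0 a4 b0 b4.
have ae : 0 <= a * e by exact: mulr_ge0.
have bf : b * f <= 4^-1 * (4^-1 / 4) by apply: ler_pM => //; lra.
have s0 : 0 <= (J - I) * (a + b) by apply: mulr_ge0; lra.
have s2 : (J - I) * (a + b) <= (J - I) * 2^-1 by apply: ler_wpM2l; lra.
by rewrite ltr_norml; apply/andP; split; lra.
Qed.

(** Between base points the [v_i] component is [delta * (J - I) ^+ 2], at least [delta]; the offsets
    lower it by at most [delta / 4 + delta / 16]. *)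
Lemma long_step_inward p q : in_range p -> in_range q -> p.1 != q.1 ->
  0 < - 2 * (delta * p.1%:R) * (px q - px p) + (py q - py p).
Proof.
move=> /in_range_bounds[a0 a4 e0 e4 d4] /in_range_bounds[b0 b4 f0 f4 _] ne.
have : 1 <= (q.1%:R - p.1%:R) ^+ 2 :> R.
  have [lt|lt|e] := ltngtP p.1 q.1; last by rewrite e eqxx in ne.
  - have : p.1%:R + 1 <= q.1%:R :> R by rewrite natr1 ler_nat.
    by nra.
  - have : q.1%:R + 1 <= p.1%:R :> R by rewrite natr1 ler_nat.
    by nra.
rewrite /px /py; move: a0 a4 e0 e4 b0 b4 f0 f4.
set I := p.1%:R; set J := q.1%:R; set e := eps * _; set f := eps * _.
move=> a0 a4 e0 e4 b0 b4 f0 f4 IJ.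
rewrite [ltRHS](_ : _ = delta * (J - I) ^+ 2 + 4 * ((delta * I) * (delta * J) * f)
  - 4 * ((delta * I) * (delta * I) * e) + (f - e)); last by ring.
have dIJ : delta <= delta * (J - I) ^+ 2 by rewrite ler_peMr // ltW.
move: (delta * I) (delta * J) a0 a4 b0 b4 => a b a0 a4 b0 b4.
have abf : 0 <= a * b * f by apply: mulr_ge0 => //; apply: mulr_ge0.
have aa : a * a <= 4^-1 * 4^-1 by apply: ler_pM.
have aae : a * a * e <= 4^-1 * 4^-1 * (delta / 4).
  by apply: ler_pM => //; apply: mulr_ge0.
by have := delta0; lra.
Qed.

Lemma cluster_step p q : p.1 = q.1 ->
  px q - px p = - 2 * (delta * p.1%:R) * (eps * (q.2%:R - p.2%:R)) /\
  py q - py p = eps * (q.2%:R - p.2%:R).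
Proof. by rewrite /px /py => ->; split; ring. Qed.

Lemma obtuse_cluster_turn p q r : in_range p -> in_range q -> in_range r ->
  0 < dotv (pt q - pt p) (pt r - pt q) -> cluster_turn p q r.
Proof.
move=> pr qr rr; rewrite dotv_pt /cluster_turn.
have eps_gt (i j : nat) : (0 < eps * (j%:R - i%:R)) = (i < j)%N.
  by rewrite pmulr_rgt0 // subr_gt0 ltr_nat.
case: eqP => [pq|/eqP pq]; case: eqP => [qre|/eqP qre].
- have [-> ->] := cluster_step pq; have [-> ->] := cluster_step qre.
  rewrite -pq; set c := - 2 * _; move: (eps_gt p.2 q.2) (eps_gt q.2 r.2).
  move: (eps_gt q.2 p.2) (eps_gt r.2 q.2).
  set s := eps * (q.2%:R - p.2%:R); set t := eps * (r.2%:R - q.2%:R).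
  have -> : eps * (p.2%:R - q.2%:R) = - s by rewrite /s; ring.
  have -> : eps * (q.2%:R - r.2%:R) = - t by rewrite /t; ring.
  rewrite !oppr_gt0 => <- <- <- <-.
  (* Both steps are multiples of the same normal, whose squared length is [c ^+ 2 + 1]. *)
  have -> : c * s * (c * t) + s * t = (s * t) * (c ^+ 2 + 1) by ring.
  rewrite pmulr_lgt0; last by rewrite ltr_wpDl // sqr_ge0.
  have [s0|s0|->] := ltgtP s 0; last by rewrite mul0r ltxx.
  + by rewrite nmulr_rgt0 // => ->.
  + by rewrite pmulr_rgt0 // => ->.
- have [-> ->] := cluster_step pq; rewrite pq.
  have := long_step_inward qr rr qre; set w := (X in 0 < X) => w0.
  rewrite [ltRHS](_ : _ = eps * (q.2%:R - p.2%:R) * w); last by rewrite /w; ring.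
  by rewrite pmulr_lgt0 // eps_gt.
- have [-> ->] := cluster_step qre.
  (* The entering step is reversed, so that it leaves the cluster of [q]. *)
  have := long_step_inward qr pr _; rewrite eq_sym => /(_ pq).
  set w := (X in 0 < X) => w0.
  rewrite [ltRHS](_ : _ = eps * (q.2%:R - r.2%:R) * w); last by rewrite /w; ring.
  by rewrite pmulr_lgt0 // eps_gt.
(* Two mostly horizontal steps in opposite directions have a negative dot product, so the cluster
   index cannot turn back. *)
- have opp_lt (x y x' y' : R) : `|y| < x -> `|y'| < x' -> x * - x' + y * - y' < 0.
    move=> yx yx'.
    have : `|y * y'| < x * x' by rewrite normrM ltr_pM.
    by rewrite ltr_norml => /andP[]; lra.
  have [lt1|lt1|e] := ltngtP p.1 q.1; last by rewrite e eqxx in pq.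
  + have [lt2|lt2|e] := ltngtP q.1 r.1; [by []| |by rewrite e eqxx in qre].
    have := opp_lt _ _ _ _ (long_step_flat pr qr lt1) (long_step_flat rr qr lt2).
    by rewrite !opprB; lra.
  + have [lt2|lt2|e] := ltngtP q.1 r.1; [|by []|by rewrite e eqxx in qre].
    have := opp_lt _ _ _ _ (long_step_flat qr pr lt1) (long_step_flat qr rr lt2).
    by lra.
Qed.

Lemma pt_inj : {in in_range &, injective pt}.
Proof.
move=> p q pr qr e.
have ex : px p = px q by have /rowP/(_ 0) := e; rewrite !mxE.
have ey : py p = py q by have /rowP/(_ 1) := e; rewrite !mxE.
have [pq|pq] := eqVneq p.1 q.1; last first.
  by have := long_step_inward pr qr pq; rewrite ex ey !subrr mulr0 addr0 ltxx.
have [_] := cluster_step pq; rewrite ey subrr => /esym/eqP.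
rewrite mulf_eq0 gt_eqF //= subr_eq0 eqr_nat => /eqP.
by case: p q pq {pr qr e ex ey} => [i j] [i' j'] /= -> ->.
Qed.

Lemma short_trajectories (n : nat) : (n <= m * m)%N ->
  exists2 X : {fset 'rV[R]_2}, #|` X| = n &
    forall G, admissible X G -> (size G <= 3 * m)%N.
Proof.
move=> nm; pose grid := take n [seq (i, j) | i <- iota 0 m, j <- iota 0 m].
have gridP : {in grid, forall p, in_range p}.
  move=> p /mem_take/allpairsP[[i j] /= [ii jj ->]]; rewrite /in_range /=.
  by move: ii jj; rewrite !mem_iota /= !add0n => -> ->.
have ug : uniq grid.
  by apply/take_uniq/allpairs_uniq; rewrite ?iota_uniq // => -[? ?] [? ?].
have sg : size grid = n by rewrite size_takel // size_allpairs !size_iota.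
have up : uniq (map pt grid).
  rewrite map_inj_in_uniq // => p q /gridP pr /gridP qr; exact: pt_inj.
exists (seq_fset tt (map pt grid)); first by rewrite size_seq_fset undup_id // size_map.
move=> G [_ _ GX turn].
(* The trajectory is pulled back along [pt] to a walk on index pairs. *)
have /subset_mapP[g /allP gg Gg] : {subset G <= map pt grid}.
  by move=> x /GX; rewrite seq_fsetE.
rewrite {}Gg size_map in turn *.
apply: cluster_walk_size => [|k klt]; first by apply/allP => p /gg/gridP.
have k1 := ltnW klt; have k0 := ltnW k1.
have := turn k klt; rewrite angle_obtuseE !(nth_map (0, 0)%N) //.
by apply: obtuse_cluster_turn; apply/gridP/gg/mem_nth.
Qed.

End UpperBound.

Theorem mainTheorem1 (R : realType) (n : nat) (hn : (1 <= n)%N) :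
  (forall X : {fset 'rV[R]_2}, #|` X| = n ->
     exists2 G : seq 'rV[R]_2, admissible X G &
       Num.floor (Num.sqrt (n%:R - 1 : R) + 1) <= (size G)%:Z)
  /\
  (exists2 X : {fset 'rV[R]_2}, #|` X| = n &
     forall G : seq 'rV[R]_2, admissible X G ->
       (size G)%:Z <= 3 * Num.ceil (Num.sqrt (n%:R : R))).
Proof.
split.
- move=> X Xn; have n1 : 0 <= n%:R - 1 :> R by rewrite subr_ge0 ler1n.
  have : 0 <= Num.floor (Num.sqrt (n%:R - 1 : R)) by rewrite floor_ge0 sqrtr_ge0.
  have := floor_le (Num.sqrt (n%:R - 1 : R)).
  (* With [k] the floor of the root, [k * k <= n - 1 < n], and the summand 1 matches the strict
     bound [k < size G]. *)
  rewrite floorDrz ?rpred1 // floor1.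
  case: (Num.floor _) => // k kle _.
  have /long_trajectory[G GX sG] : (k * k < #|` X|)%N.
    have : (k%:R : R) ^+ 2 <= n%:R - 1.
      by rewrite -(sqr_sqrtr n1) ler_pXn2r // ?nnegrE ?sqrtr_ge0.
    by rewrite Xn lerBrDr -natrX natr1 ler_nat expnS expn1.
  by exists G => //; move: sG; lia.
- have : 0 < Num.ceil (Num.sqrt (n%:R : R)) by rewrite ceil_gt0 sqrtr_gt0 ltr0n.
  have := ceil_ge (Num.sqrt (n%:R : R)).
  case: (Num.ceil _) => // m mge m0.
  have {}m0 : 0 < m%:R :> R by rewrite ltr0n.
  (* These values turn both smallness conditions into equalities. *)
  pose delta : R := (4 * m%:R)^-1; pose eps := delta / 4 / m%:R.
  have nm : (n <= m * m)%N.
    have : n%:R <= (m%:R : R) ^+ 2.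
      by rewrite -(@sqr_sqrtr _ n%:R) // ler_pXn2r // ?nnegrE ?sqrtr_ge0 // ltW.
    by rewrite -natrX ler_nat expnS expn1.
  have d0 : 0 < delta by rewrite invr_gt0 mulr_gt0.
  have e0 : 0 < eps by rewrite !divr_gt0.
  have [||X Xn XG] := short_trajectories d0 e0 _ _ nm.
  + by rewrite /delta invfM divfK ?gt_eqF.
  + by rewrite /eps divfK ?gt_eqF.
  by exists X => // G /XG; lia.
Qed.
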